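(* Let $m,n$ be positive integers and let $\mathcal{A}$ be a real centrosymmetric tensor of order $m$ and dimension $n$. If $\lambda$ is an H-eigenvalue of $\mathcal{A}$ with an H-eigenvector $x$, then $Jx$ is also an H-eigenvector of $\mathcal{A}$ corresponding to $\lambda$.
   Context: A real tensor of order $m$ and dimension $n$ is an array $\mathcal{A}=(a_{i_1\cdots i_m})$ of reals with $i_1,\dots,i_m\in[n]=\{1,\dots,n\}$. It is centrosymmetric if $a_{i_1\cdots i_m}=a_{n-i_1+1,\dots,n-i_m+1}$ for all indices. For $x\in\mathbb{R}^n$, $\mathcal{A}x^{m-1}\in\mathbb{R}^n$ has $i$-th component $\sum_{i_2,\dots,i_m=1}^n a_{ii_2\cdots i_m}x_{i_2}\cdots x_{i_m}$, and $x^{[m-1]}=(x_1^{m-1},\dots,x_n^{m-1})$. If $\lambda\in\mathbb{R}$ and $x\in\mathbb{R}^n\setminus\{0\}$ satisfy $\mathcal{A}x^{m-1}=\lambda x^{[m-1]}$, then $\lambda$ is an H-eigenvalue of $\mathcal{A}$ and $x$ an H-eigenvector corresponding to $\lambda$. $J$ is the $n\times n$ matrix with $J_{ij}=\delta_{i,\,n-j+1}$, so $(Jx)_i=x_{n-i+1}$. *)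

(* Defs.v *)
From mathcomp Require Import all_boot all_order all_algebra.
From mathcomp Require Import reals.

Set Implicit Arguments.
Unset Strict Implicit.
Unset Printing Implicit Defensive.

Import GRing.Theory.

Local Open Scope ring_scope.

(* Indices are 0-based: [n] is 'I_n, and the reflection i |-> n - i + 1 of the
   1-based indices is rev_ord, whose value at i is n - i.+1. *)

Definition tensor (R : realType) (m n : nat) := {ffun m.-tuple 'I_n -> R}.

Definition centrosymmetric (R : realType) (m n : nat) (A : tensor R m n) : Prop :=
  forall t : m.-tuple 'I_n, A t = A (map_tuple (@rev_ord n) t).

(* The vector written A x^{m-1} for a tensor of order m; the order is m.+1
   here, so that the multi-index is i followed by an m-tuple. *)
Definition tensor_apply (R : realType) (m n : nat) (A : tensor R m.+1 n)
    (x : 'cV[R]_n) : 'cV[R]_n :=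
  \col_(i < n) \sum_(t : m.-tuple 'I_n)
    A (cons_tuple i t) * \prod_(k < m) x (tnth t k) 0.

(* The entrywise power x^{[k]}. *)
Definition vec_pow (R : realType) (n : nat) (x : 'cV[R]_n) (k : nat) : 'cV[R]_n :=
  \col_(i < n) x i 0 ^+ k.

(* "lam is an H-eigenvalue of A and x is an H-eigenvector corresponding to lam" *)
Definition H_eigenpair (R : realType) (m n : nat) (A : tensor R m.+1 n)
    (lam : R) (x : 'cV[R]_n) : Prop :=
  x <> 0 /\ tensor_apply A x = lam *: vec_pow x m.

Definition exchange_mx (R : realType) (n : nat) : 'M[R]_n :=
  \matrix_(i < n, j < n) (i == rev_ord j)%:R.

(* Main.v *)
(* Reindexing the sum defining A(Jx)^{m-1} by the involution t |-> rev t of the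
   multi-indices and using centrosymmetry gives A(Jx)^{m-1} = J(A x^{m-1}),
   and J commutes with entrywise powers. *)
Require Import Defs.
From mathcomp Require Import all_boot all_order all_algebra.
From mathcomp Require Import reals.

Import GRing.Theory.

Local Open Scope ring_scope.

(** J permutes coordinates by an involution, so Jx is nonzero when x is. Since J commutes both with
    x -> A x^{m-1} ([tensor_apply_exchange]) and with entrywise powers ([vec_pow_exchange]),
    applying J to the eigenvalue equation of x gives that of Jx. *)

Lemma exchange_mxE (R : realType) (n p : nat) (x : 'M[R]_(n, p)) i j :
  (exchange_mx R n *m x) i j = x (rev_ord i) j.
Proof.
rewrite mxE (bigD1 (rev_ord i)) //= mxE rev_ordK eqxx mul1r big1 ?addr0 //.
by move=> k /negbTE ki; rewrite mxE -(inj_eq rev_ord_inj) rev_ordK eq_sym ki mul0r.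
Qed.

Lemma exchange_mxK (R : realType) (n p : nat) :
  involutive (mulmx (exchange_mx R n) : 'M[R]_(n, p) -> 'M[R]_(n, p)).
Proof. by move=> x; apply/matrixP => i j; rewrite !exchange_mxE rev_ordK. Qed.

Lemma map_tuple_involutive (T : Type) (m : nat) (f : T -> T) :
  involutive f -> involutive (@map_tuple m T T f).
Proof. by move=> fK t; apply: val_inj; exact: mapK. Qed.

Lemma tensor_apply_exchange (R : realType) (m n : nat) (A : tensor R m.+1 n)
    (x : 'cV[R]_n) :
  centrosymmetric A ->
  tensor_apply A (exchange_mx R n *m x) = exchange_mx R n *m tensor_apply A x.
Proof.
move=> hA; apply/colP => i; rewrite exchange_mxE !mxE.
rewrite [RHS](reindex_inj (inv_inj (map_tuple_involutive _ m _ (@rev_ordK n)))).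
apply: eq_bigr => t _; congr (_ * _).
  (* Centrosymmetry reflects the whole index [cons_tuple i t], head included. The head matches the
     row [rev_ord i] that J selects on the right, the tail the reindexed [t]. *)
  by rewrite hA; congr (A _); apply: val_inj.
by apply: eq_bigr => k _; rewrite exchange_mxE tnth_map.
Qed.

Lemma vec_pow_exchange (R : realType) (n : nat) (x : 'cV[R]_n) (k : nat) :
  vec_pow (exchange_mx R n *m x) k = exchange_mx R n *m vec_pow x k.
Proof. by apply/colP => i; rewrite exchange_mxE [LHS]mxE exchange_mxE mxE. Qed.

Theorem theorem4p3 (R : realType) (m n : nat) (A : tensor R m.+1 n.+1)
    (hA : centrosymmetric A) (lam : R) (x : 'cV[R]_n.+1)
    (hx : H_eigenpair A lam x) :
  H_eigenpair A lam (exchange_mx R n.+1 *m x).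
Proof.
case: hx => x0 Ax; split.
  by move=> Jx0; apply: x0; rewrite -[x]exchange_mxK Jx0 mulmx0.
by rewrite tensor_apply_exchange // Ax vec_pow_exchange scalemxAr.
Qed.
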